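(* The cubic edge-type relaxation (the system of linear constraints on type densities defined in the context) has a feasible point with uncovered-vertex density $\rho > 0$. Hence no family of linear inequalities valid at all feasible points of the relaxation (that is, no linear discharging over edge-multiplicity profiles together with the counting constraints) can force $\rho = 0$.
   Context: The cubic edge-type relaxation is the following linear system. A type is a pair $t=(C,U)$ where $C$ is a multiset of size at most $2$ with entries in $\{1,2,3\}$ (the ''chosen'' multiset) and $U$ is a multiset of size at most $2$ with entries in $\{0,1,2\}$ (the ''unchosen'' multiset). For a type $t=(C,U)$ let $p_t,q_t$ be the numbers of entries of $C$ equal to $1$ and $2$ respectively, and $a_t,b_t$ the numbers of entries of $U$ equal to $0$ and $1$ respectively. For each $j$, let $c_j(t)$ be the number of entries of $C$ equal to $j$ and $u_j(t)$ the number of entries of $U$ equal to $j$. A feasible point is a probability density $x=(x_t)$ over types (all $x_t \ge 0$, $\sum_t x_t = 1$) such that: (i) (per-edge inequality) every type $t$ with $x_t>0$ satisfies $3p_t+q_t \ge 3a_t+b_t$; (ii) (counting constraints) $\sum_t x_t u_1(t) = 2\sum_t x_t c_1(t)$ and $\sum_t x_t c_2(t) = 2\sum_t x_t u_2(t)$. The uncovered-vertex density of $x$ is $\rho = \tfrac13\sum_t x_t u_0(t)$. (Origin of the system: in a cubic graph with a maximal matching $M$ and one chosen endpoint per $M$-edge, a vertex not covered by $M$ is at risk if its three neighbours lie on distinct $M$-edges, and its multiplicity is its number of chosen neighbours. The type of an $M$-edge records the multisets of multiplicities of the at-risk neighbours of its chosen and unchosen endpoint, and $x_t$ is the fraction of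 $M$-edges of type $t$.) *)

(* Defs.v *)
From mathcomp Require Import all_boot all_order all_algebra.

Set Implicit Arguments.
Unset Strict Implicit.
Unset Printing Implicit Defensive.

Import Order.TTheory GRing.Theory Num.Theory.

Local Open Scope ring_scope.

(* A multiset of size at most 2 with entries in {0, 1, 2, 3}, given by its
   multiplicities: m j is the number of entries equal to j.  Each multiplicity
   is at most 2, so 'I_3 suffices; the bound on the total size is imposed in
   is_edge_type. *)
Definition multiplicities := {ffun 'I_4 -> 'I_3}.

Definition msize (m : multiplicities) : nat := (\sum_j m j)%N.

Definition entries_in (s : seq nat) (m : multiplicities) : bool :=
  [forall j : 'I_4, (0 < m j)%N ==> (val j \in s)].

(* The pair is (C, U): first the chosen multiset, then the unchosen one. *)
Definition is_edge_type (t : multiplicities * multiplicities) : bool :=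
  [&& (msize t.1 <= 2)%N, entries_in [:: 1; 2; 3]%N t.1,
      (msize t.2 <= 2)%N & entries_in [:: 0; 1; 2]%N t.2].

Definition edge_type := {t : multiplicities * multiplicities | is_edge_type t}.

(* Only meaningful for j < 4, because of inord. *)
Definition chosen_count (j : nat) (t : edge_type) : nat := (val t).1 (inord j).
Definition unchosen_count (j : nat) (t : edge_type) : nat :=
  (val t).2 (inord j).

Definition per_edge_ineq (t : edge_type) : bool :=
  (3 * unchosen_count 0 t + unchosen_count 1 t
     <= 3 * chosen_count 1 t + chosen_count 2 t)%N.

Section Relaxation.
Variable R : realFieldType.
Implicit Type x : edge_type -> R.

Definition density x : Prop := (forall t, 0 <= x t) /\ \sum_t x t = 1.

Definition supported_on_per_edge_ineq x : Prop :=
  forall t, 0 < x t -> per_edge_ineq t.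

Definition counting_constraints x : Prop :=
  \sum_t x t * (unchosen_count 1 t)%:R
    = 2 * \sum_t x t * (chosen_count 1 t)%:R
  /\ \sum_t x t * (chosen_count 2 t)%:R
    = 2 * \sum_t x t * (unchosen_count 2 t)%:R.

Definition feasible x : Prop :=
  [/\ density x, supported_on_per_edge_ineq x & counting_constraints x].

Definition uncovered_density x : R :=
  3^-1 * \sum_t x t * (unchosen_count 0 t)%:R.

(* The inequality \sum_t a t * x t <= b; reversed inequalities and equations
   are obtained by negating a and b. *)
Definition satisfies_lin_ineq (a : edge_type -> R) (b : R) x : Prop :=
  \sum_t a t * x t <= b.

Definition valid_family (I : Type) (a : I -> edge_type -> R) (b : I -> R) :
    Prop :=
  forall i x, feasible x -> satisfies_lin_ineq (a i) (b i) x.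

(* The family may be combined with every constraint of the relaxation.  This
   is the weakest notion of forcing, so that its failure is the strongest:
   it implies failure when x is only required to satisfy the family itself,
   or the family together with the counting constraints. *)
Definition forces_uncovered_density_zero (I : Type)
    (a : I -> edge_type -> R) (b : I -> R) : Prop :=
  forall x, feasible x -> (forall i, satisfies_lin_ineq (a i) (b i) x) ->
    uncovered_density x = 0.

End Relaxation.

(* Main.v *)
(** A feasible point with two types suffices: ({1,1}, {0,0}) with density 1/5
    and ({2,2}, {1,2}) with density 4/5.  The first type supplies the uncovered
    vertices and has all the entries 1 of chosen multisets; the second has
    c_2 = 2 u_2, so it is balanced for the second counting constraint, and 4/5
    of it supplies the entries 1 of unchosen multisets that the first type
    requires.  The uncovered density is 2/15.  A valid family holds at this
    point, hence cannot force zero. *)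
Require Import Defs.
From mathcomp Require Import all_boot all_order all_algebra.
From mathcomp Require Import lra.

Set Implicit Arguments.
Unset Strict Implicit.
Unset Printing Implicit Defensive.

Import Order.TTheory GRing.Theory Num.Theory.
Local Open Scope ring_scope.

(* Junk value: entries above 3 are dropped, and inord sends a multiplicity
   above 2 to 0. *)
Definition multiset_of (s : seq nat) : multiplicities :=
  [ffun j : 'I_4 => inord (count_mem (j : nat) s)].

Lemma multiset_ofE (s : seq nat) (j : 'I_4) :
  (size s <= 2)%N -> multiset_of s j = count_mem (j : nat) s :> nat.
Proof.
by move=> s2; rewrite ffunE inordK // ltnS (leq_trans (count_size _ _)).
Qed.

(** Each entry of [s] is counted for exactly one [j] if it is below [n], and for none otherwise. *)
Lemma sum_count_mem_leq (n : nat) (s : seq nat) :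
  (\sum_(j < n) count_mem (j : nat) s <= size s)%N.
Proof.
elim: s => [|i s IHs] /=; first by rewrite big1.
rewrite big_split -add1n leq_add //=.
have [i_lt_n|n_le_i] := ltnP i n.
  rewrite (bigD1 (Ordinal i_lt_n)) //= eqxx big1 // => j.
  by rewrite -val_eqE /= eq_sym => /negbTE ->.
rewrite big1 // => j _; case: eqP n_le_i => // ->.
by rewrite leqNgt ltn_ord.
Qed.

Lemma msize_multiset_of (s : seq nat) :
  (size s <= 2)%N -> (msize (multiset_of s) <= 2)%N.
Proof.
move=> s2; apply: leq_trans s2; apply: leq_trans (sum_count_mem_leq 4 s).
(* [inord] either keeps the count or replaces it by 0, so it never exceeds it. *)
by apply: leq_sum => j _; rewrite ffunE /inord /insubd; case: insubP => //= u _ ->.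
Qed.

Lemma entries_in_multiset_of (r s : seq nat) :
  (size s <= 2)%N -> all (mem r) s -> entries_in r (multiset_of s).
Proof.
move=> s2 /allP sr; apply/forallP => j; apply/implyP.
by rewrite multiset_ofE // -has_count has_pred1 => /sr.
Qed.

Section EdgeTypeOf.
Variables c u : seq nat.
Hypotheses (c_size : (size c <= 2)%N) (c_in : all (mem [:: 1; 2; 3]%N) c).
Hypotheses (u_size : (size u <= 2)%N) (u_in : all (mem [:: 0; 1; 2]%N) u).

Lemma is_edge_type_multiset_of : is_edge_type (multiset_of c, multiset_of u).
Proof.
by apply/and4P; split; rewrite ?msize_multiset_of ?entries_in_multiset_of.
Qed.

Definition edge_type_of : edge_type := Sub _ is_edge_type_multiset_of.

Lemma chosen_count_of (j : nat) :
  (j < 4)%N -> chosen_count j edge_type_of = count_mem j c.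
Proof. by move=> j4; rewrite /chosen_count multiset_ofE // inordK. Qed.

Lemma unchosen_count_of (j : nat) :
  (j < 4)%N -> unchosen_count j edge_type_of = count_mem j u.
Proof. by move=> j4; rewrite /unchosen_count multiset_ofE // inordK. Qed.

End EdgeTypeOf.

Definition type_11_00 : edge_type :=
  @edge_type_of [:: 1; 1]%N [:: 0; 0]%N isT isT isT isT.

Definition type_22_12 : edge_type :=
  @edge_type_of [:: 2; 2]%N [:: 1; 2]%N isT isT isT isT.

Definition edge_type_countE := (chosen_count_of, unchosen_count_of).

Section Witness.
Variable R : realFieldType.

Definition witness (t : edge_type) : R :=
  5^-1 * (t == type_11_00)%:R + 4 / 5 * (t == type_22_12)%:R.

(** Total mass, both counting constraints and the uncovered density are all sums of this shape, so
    each becomes arithmetic on two terms. *)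
Lemma sum_witness (f : edge_type -> R) :
  \sum_t witness t * f t = 5^-1 * f type_11_00 + 4 / 5 * f type_22_12.
Proof.
have sum_indic (c : R) (t0 : edge_type) :
    \sum_t c * (t == t0)%:R * f t = c * f t0.
  rewrite (bigD1 t0) //= eqxx mulr1 big1 ?addr0 // => t /negbTE ->.
  by rewrite mulr0 mul0r.
rewrite -!sum_indic -big_split /=.
by apply: eq_bigr => t _; rewrite mulrDl.
Qed.

Lemma witness_feasible : feasible witness.
Proof.
split.
- split=> [t|]; first by rewrite /witness; do 2 case: eqP => _ /=; lra.
  (* The total mass is the case of the constant function 1. *)
  under eq_bigr do rewrite -[witness _]mulr1.
  by rewrite sum_witness; lra.
- move=> t; rewrite /witness.
  (* The inequality reads 6 <= 6 at [type_11_00] and 1 <= 2 at [type_22_12]; at any other type the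
     weight is 0. *)
  have [->|_] := eqVneq t type_11_00;
    first by rewrite /per_edge_ineq !edge_type_countE.
  have [->|_] := eqVneq t type_22_12;
    first by rewrite /per_edge_ineq !edge_type_countE.
  by rewrite !mulr0 addr0 ltxx.
(* The two equations are 4/5 = 2 * (2/5) and 8/5 = 2 * (4/5). *)
- by split; rewrite !sum_witness !edge_type_countE //=; lra.
Qed.

Lemma uncovered_density_witness : uncovered_density witness = 2 / 15.
Proof. by rewrite /uncovered_density sum_witness !edge_type_countE //=; lra. Qed.

End Witness.

Theorem proposition4 (R : realFieldType) :
  (exists2 x : edge_type -> R, feasible x & 0 < uncovered_density x) /\
  (forall (I : Type) (a : I -> edge_type -> R) (b : I -> R),
     valid_family a b -> ~ forces_uncovered_density_zero a b).
Proof.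
have x_feas := witness_feasible R.
have x_pos : 0 < uncovered_density (@witness R).
  by rewrite uncovered_density_witness; lra.
split; first by exists (@witness R).
move=> I a b valid forces; move: x_pos.
by rewrite (forces _ x_feas) ?ltxx // => i; apply: valid.
Qed.
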